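(* Let $3<p<\infty$ and $\frac1p+\frac1q=1$. Let $\mathfrak J:l_p\to l_q$ be the mapping $\mathfrak J(x)=\left\{\frac{|t_n|^{p-1}\mathrm{sign}(t_n)}{1+|t_n|}\right\}_{n=1}^\infty$ for $x=(t_1,t_2,\dots)\in l_p$. Then $\mathfrak J$ is Gâteaux differentiable in $l_p$ and, for any $\bar x=(\bar t_1,\bar t_2,\dots)\in l_p$, the Gâteaux derivative $\mathfrak J'(\bar x)$ satisfies, for any $v=\{t_n\}_{n=1}^\infty\in l_p\setminus\{\theta\}$, $$\mathfrak J'(\bar x)(v)=\nabla\mathfrak J(\bar x)(v)=\left\{\frac{(p-1)|\bar t_n|^{p-2}+(p-2)|\bar t_n|^{p-1}}{(1+|\bar t_n|)^2}\,t_n\right\}_{n=1}^\infty\in l_q.$$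
   Context: $(l_p,\|\cdot\|_p)$ and $(l_q,\|\cdot\|_q)$ are the real sequence spaces, $\theta=(0,0,\dots)$. The Gâteaux derivative is $\mathfrak J'(\bar x)(v)=\lim_{t\to0}\frac{\mathfrak J(\bar x+tv)-\mathfrak J(\bar x)}{t}$ (limit in $l_q$, $t$ real), and $\mathfrak J$ is Gâteaux differentiable at $\bar x$ if this limit exists for every $v\in l_p\setminus\{\theta\}$. $\nabla\mathfrak J(\bar x)$ is the Fréchet derivative of $\mathfrak J$ at $\bar x$. *)

(* Defs.v *)
From HB Require Import structures.
From mathcomp Require Import all_boot all_order all_algebra.
From mathcomp Require Import all_classical all_reals all_analysis.
From mathcomp Require Import lra.
Set Implicit Arguments.
Unset Strict Implicit.
Unset Printing Implicit Defensive.
Import Order.TTheory GRing.Theory Num.Theory.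
Import numFieldNormedType.Exports.
Local Open Scope classical_set_scope.
Local Open Scope ring_scope.

(* The real sequence space l_p is L^p(nat, counting measure). For the counting
   measure, equality almost everywhere is equality, so no quotient is needed:
   the elements are the sequences themselves. *)
Definition ell (R : realType) (p : R) (p1 : (1 <= p%:E)%E) : Type :=
  LfunType (@counting nat R) p1.

Section ell_normed.
Context (R : realType) (p : R) (p1 : (1 <= p%:E)%E).

HB.instance Definition _ := GRing.Lmodule.copy (ell p1) (LfunType (@counting nat R) p1).

Definition ell_norm (x : ell p1) : R :=
  fine ('N[@counting nat R]_(p%:E) [EFin \o (x : nat -> R)])%E.

Lemma ell_p_gt0 : 0 < p.
Proof. by move: p1; rewrite lee_fin; apply: lt_le_trans. Qed.

Lemma ell_normE (x : ell p1) :
  (ell_norm x)%:E = ((\sum_(0 <= n <oo) (`|x n| `^ p)%:E) `^ p^-1)%E.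
Proof.
by rewrite /ell_norm finite_norm_fine Lnorm_counting ?ell_p_gt0.
Qed.

Let ell_normD (x y : ell p1) : ell_norm (x + y) <= ell_norm x + ell_norm y.
Proof. exact: ler_LnormD. Qed.

Let ell_normZ (a : R) (x : ell p1) : ell_norm (a *: x) = `|a| * ell_norm x.
Proof.
apply: EFin_inj; rewrite EFinM /ell_norm !finite_norm_fine.
exact: LnormZ.
Qed.

Let ell_norm_eq0 (x : ell p1) : ell_norm x = 0 -> x = 0.
Proof.
move=> nx0; have := ell_normE x; rewrite nx0 => /esym x0.
have s0 : (\sum_(0 <= n <oo) (`|x n| `^ p)%:E = 0)%E.
  apply: poweR_eq0_eq0 x0.
  by apply: nneseries_ge0 => k _ _; rewrite lee_fin powR_ge0.
apply: (iffRL (LfuneqP x 0)) => n.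
have := @nneseries_lim_ge R (fun n => (`|x n| `^ p)%:E) xpredT 0 n.+1.
move=> /(_ (fun k _ => ltac:(by rewrite lee_fin powR_ge0))) H.
move: H; rewrite s0 big_nat_recr//= => H.
have : ((`|x n| `^ p)%:E <= 0)%E.
  apply: le_trans H; rewrite leeDr//.
  by apply: sume_ge0 => k _; rewrite lee_fin powR_ge0.
rewrite lee_fin => H'.
have /powR_eq0_eq0/normr0_eq0// : `|x n| `^ p = 0.
by apply/eqP; rewrite eq_le H' powR_ge0.
Qed.

HB.instance Definition _ :=
  Lmodule_isNormed.Build R (ell p1) ell_normD ell_normZ ell_norm_eq0.

End ell_normed.

Section J.
Context (R : realType) (p q : R).
Context (p1 : (1 <= p%:E)%E) (q1 : (1 <= q%:E)%E) (pq : p^-1 + q^-1 = 1).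

Definition J_seq (x : nat -> R) : nat -> R :=
  fun n => `|x n| `^ (p - 1) * Num.sg (x n) / (1 + `|x n|).

Let mulBq : (p - 1) * q = p.
Proof.
have p0 : p != 0 by rewrite gt_eqF// (ell_p_gt0 p1).
have q0 : q != 0 by rewrite gt_eqF// (ell_p_gt0 q1).
have := congr1 (fun z => p * q * z) pq.
rewrite mulrDr mulr1 mulfK// mulrAC divff// mul1r => pqE.
by rewrite mulrBl mul1r -pqE addrAC subrr add0r.
Qed.

Let J_seq_le (x : nat -> R) n : `|J_seq x n| `^ q <= `|x n| `^ p.
Proof.
rewrite -[in leRHS]mulBq powRrM ge0_ler_powR ?nnegrE ?powR_ge0//.
  exact/ltW/(ell_p_gt0 q1).
have d1 : 1 <= 1 + `|x n| by rewrite lerDl.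
have d0 : 0 < 1 + `|x n| by exact: lt_le_trans d1.
rewrite /J_seq !normrM normfV (gtr0_norm d0) (ger0_norm (powR_ge0 _ _)).
rewrite -mulrA ler_piMr ?powR_ge0// ler_pdivrMr// mul1r.
by rewrite (le_trans _ d1)// normr_sg lern1 leq_b1.
Qed.

Lemma J_seq_ell (x : ell p1) : J_seq x \in Lfun (@counting nat R) q%:E.
Proof.
apply/andP; split; rewrite inE//=.
have p0 := ell_p_gt0 p1; have q0 := ell_p_gt0 q1.
have xp : (\sum_(0 <= n <oo) (`|x n| `^ p)%:E < +oo)%E.
  have : finite_norm (@counting nat R) p%:E x by exact: Lfunction_finite.
  rewrite /finite_norm Lnorm_counting// => /lty_poweRy; apply.
  by rewrite invr_neq0// gt_eqF.
rewrite /finite_norm Lnorm_counting//; apply: poweR_lty.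
apply: le_lt_trans xp; apply: lee_nneseries => n _.
  by rewrite lee_fin powR_ge0.
by rewrite lee_fin; exact: J_seq_le.
Qed.

Definition J (x : ell p1) : ell q1 := Lfun_Sub q1 (J_seq_ell x).

End J.
Arguments J {R p q p1 q1} pq x.

Section exponents.
Context (R : realType) (p q : R).

Lemma exponent_ge1 : 3 < p -> (1 <= p%:E)%E.
Proof. by rewrite lee_fin => p3; lra. Qed.

Lemma conjugate_exponent_ge1 : 3 < p -> p^-1 + q^-1 = 1 -> (1 <= q%:E)%E.
Proof.
move=> p3 pq; have pV0 : 0 < p^-1 by rewrite invr_gt0; lra.
have pV1 : p^-1 < 1 by rewrite invf_lt1; lra.
have qV0 : 0 < q^-1 by lra.
by rewrite lee_fin -[q]invrK invf_ge1//; lra.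
Qed.

End exponents.

Definition gateaux_differentiable (R : realType) (V W : normedModType R)
    (f : V -> W) (x : V) : Prop :=
  forall v : V, v != 0 -> derivable f x v.

(* Main.v *)
Require Import Defs.
From HB Require Import structures.
From mathcomp Require Import all_boot all_order all_algebra.
From mathcomp Require Import all_classical all_reals all_analysis.
From mathcomp Require Import ring lra.
Set Implicit Arguments.
Unset Strict Implicit.
Unset Printing Implicit Defensive.
Import Order.TTheory GRing.Theory Num.Theory.
Import numFieldNormedType.Exports.
Local Open Scope classical_set_scope.
Local Open Scope ring_scope.

(** The mapping acts coordinatewise through the scalar function
    phi(t) = |t|^(p-1) sign(t) / (1 + |t|), and the asserted derivative is
    multiplication of the n-th coordinate by phi'(x_n). Two estimates give
    Frechet differentiability, and with it the Gateaux statement.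

    The first is scalar: since p > 3, phi' is differentiable off 0 with
    |phi''(s)| <= p(p-1) |s|^(p-3), so that the first order Taylor remainder of
    phi satisfies (phi_taylor)
      |phi(t+h) - phi(t) - phi'(t) h| <= p(p-1) (|t|+|h|)^(p-3) |h|^2.
    When t and t+h have the same sign this is the mean value theorem used
    twice; when 0 lies between t and t+h, both |t| and |t+h| are at most |h| and
    each of the three terms on the left is separately of order |h|^(p-1).

    The second transfers power bounds to norms (interpolation): if
    alpha + beta = p-1 and |y_n| <= C |a_n|^alpha |h_n|^beta for all n, then y is
    in l_q and its norm is at most 2 C A^alpha ||h||^beta as soon as
    ||a|| <= A. The reason is that (p-1) q = p. With (alpha, beta) = (p-2, 1) it
    shows that multiplication by phi'(x_n) is a bounded linear map from l_p to
    l_q; with (alpha, beta) = (p-3, 2) and a = |x| + |h| it bounds the norm of the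
    remainder by a constant times ||h||^2 when ||h|| <= 1, which is o(||h||). *)

(** * The scalar Taylor estimate *)

Section mean_value.
Context {R : realType}.
Implicit Types (F dF : R -> R) (a b : R).

(** The two points come in either order, and differentiability is only asked on
    the open half-line, because powR is not differentiable at 0. *)
Lemma mean_value_gt0 F dF a b :
  (forall s : R, 0 < s -> is_derive s 1 F (dF s)) -> 0 < a -> 0 < b ->
  exists c, [/\ 0 < c, `|c - a| <= `|b - a| & F b - F a = dF c * (b - a)].
Proof.
move=> FdF.
have sub u v : 0 < u -> u <= v -> exists2 c, u <= c <= v &
    F v - F u = dF c * (v - u).
  move=> u0 uv; have [||c] := @MVT_segment _ F dF u v uv.
  - by move=> s; rewrite in_itv/= => /andP[us _]; apply: FdF; exact: lt_trans us.
  - apply: derivable_within_continuous => s; rewrite in_itv/= => /andP[us _].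
    by have [] := FdF s (lt_le_trans u0 us).
  - by rewrite in_itv/=; exists c.
move=> a0 b0; have [ab|/ltW ba] := leP a b.
  have [c /andP[ac cb] Fab] := sub _ _ a0 ab; exists c; split => //.
    exact: lt_le_trans ac.
  by rewrite !ger0_norm ?subr_ge0// lerB.
have [c /andP[bc ca] Fba] := sub _ _ b0 ba; exists c; split.
- exact: lt_le_trans bc.
- by rewrite !ler0_norm ?subr_le0// lerN2 lerB.
- by rewrite -opprB Fba -mulrN opprB.
Qed.

End mean_value.

Section scalar.
Context {R : realType} (p : R).
Implicit Types (s t h : R).

Definition phi t := `|t| `^ (p - 1) * Num.sg t / (1 + `|t|).

Definition phi' t :=
  ((p - 1) * `|t| `^ (p - 2) + (p - 2) * `|t| `^ (p - 1)) / (1 + `|t|) ^+ 2.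

Let phi'' s :=
  ((p - 1) * (p - 2) * s `^ (p - 3) + (p - 2) * (p - 1) * s `^ (p - 2))
    / (1 + s) ^+ 2
  - 2 * ((p - 1) * s `^ (p - 2) + (p - 2) * s `^ (p - 1)) / (1 + s) ^+ 3.

Lemma phiN t : phi (- t) = - phi t.
Proof. by rewrite /phi normrN sgrN mulrN mulNr. Qed.

Lemma phi'N t : phi' (- t) = phi' t.
Proof. by rewrite /phi' normrN. Qed.

Lemma powR_succ s (r : R) : 0 <= s -> 0 < r -> s `^ r = s * s `^ (r - 1).
Proof. by move=> s0 r0; rewrite mulr_powRB1. Qed.

Lemma phi_le t : `|phi t| <= `|t| `^ (p - 1).
Proof.
have t0 := normr_ge0 t.
rewrite /phi !normrM normfV (ger0_norm (powR_ge0 _ _)).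
rewrite (ger0_norm (_ : 0 <= 1 + `|t|)); last lra.
rewrite -mulrA ler_piMr ?powR_ge0// ler_pdivrMr; last lra.
by rewrite mul1r normr_sg; case: (t != 0) => /=; lra.
Qed.

Lemma phi'_le t : 2 < p -> `|phi' t| <= (p - 1) * `|t| `^ (p - 2).
Proof.
move=> p2; set s := `|t|; have s0 : 0 <= s by exact: normr_ge0.
have P0 : 0 <= s `^ (p - 2) by exact: powR_ge0.
have E : s `^ (p - 1) = s * s `^ (p - 2).
  by rewrite powR_succ//; [congr (_ * _ `^ _); ring|lra].
rewrite /phi' -/s E ger0_norm; last first.
  apply: divr_ge0; last exact: sqr_ge0.
  by apply: addr_ge0; rewrite ?mulr_ge0//; lra.
rewrite ler_pdivrMr ?exprn_gt0//; last lra.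
move: P0 s0; set P := s `^ _; clearbody s P => P0 s0.
have : 0 <= P * s * (p + (p - 1) * s) by rewrite !mulr_ge0//; nra.
by rewrite expr2; nra.
Qed.

Let derive_inv1D s : 0 < s ->
  is_derive s 1 (fun z : R => (1 + z)^-1) (- (1 + s) ^- 2 *: 1).
Proof.
move=> s0; apply: is_deriveV; first by apply: lt0r_neq0; lra.
by rewrite -[X in is_derive _ _ _ X]add0r; exact: is_deriveD.
Qed.

Lemma phi_derive s : 0 < s -> 1 < p -> is_derive s 1 phi (phi' s).
Proof.
move=> s0 p1; have s1 : 1 + s != 0 by apply: lt0r_neq0; lra.
apply: (@near_eq_is_derive _ _ _ (fun z => z `^ (p - 1) * (1 + z)^-1)).
  near=> z; have z0 : 0 < z by near: z; exact: lt_nbhsr.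
  by rewrite /phi gtr0_norm// gtr0_sg// mulr1.
have D1 := @is_derive1_powR R (p - 1) s s0.
apply: is_derive_eq (is_deriveM D1 (derive_inv1D s0)) _.
rewrite /phi' gtr0_norm// /GRing.scale/=.
rewrite (_ : p - 1 - 1 = p - 2); last ring.
rewrite (_ : s `^ (p - 1) = s * s `^ (p - 2)); last first.
  by rewrite powR_succ ?ltW//; [congr (_ * _ `^ _); ring|lra].
move: (s `^ (p - 2)) => P.
have key : s * P * (- ((1 + s) ^+ 2)^-1 * 1) + (1 + s)^-1 * ((p - 1) * P) =
  ((p - 1) * P + (p - 2) * (s * P)) / (1 + s) ^+ 2 by field.
exact: key.
Unshelve. all: by end_near. Qed.

Lemma phi'_derive s : 0 < s -> is_derive s 1 phi' (phi'' s).
Proof.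
move=> s0; have s1 : 1 + s != 0 by apply: lt0r_neq0; lra.
apply: (@near_eq_is_derive _ _ _
  (fun z => ((p - 1) *: z `^ (p - 2) + (p - 2) *: z `^ (p - 1)) *
            ((1 + z)^-1 * (1 + z)^-1))).
  near=> z; have z0 : 0 < z by near: z; exact: lt_nbhsr.
  by rewrite /phi' gtr0_norm// expr2 invfM.
have D1 := @is_derive1_powR R (p - 1) s s0.
have D2 := @is_derive1_powR R (p - 2) s s0.
have D3 := derive_inv1D s0.
apply: is_derive_eq (is_deriveM (is_deriveD (is_deriveZ (p - 1) D2)
  (is_deriveZ (p - 2) D1)) (is_deriveM D3 D3)) _.
rewrite /phi'' /GRing.scale/=.
rewrite (_ : p - 1 - 1 = p - 2); last ring.
rewrite (_ : p - 2 - 1 = p - 3); last ring.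
set P3 := s `^ (p - 3); set P2 := s `^ (p - 2); set P1 := s `^ (p - 1).
have key : ((p - 1) * P2 + (p - 2) * P1) * ((1 + s)^-1 * (- ((1 + s) ^+ 2)^-1 * 1)
  + (1 + s)^-1 * (- ((1 + s) ^+ 2)^-1 * 1)) + (1 + s)^-1 * (1 + s)^-1 *
  ((p - 1) * ((p - 2) * P3) + (p - 2) * ((p - 1) * P2)) =
  ((p - 1) * (p - 2) * P3 + (p - 2) * (p - 1) * P2) / (1 + s) ^+ 2 -
  2 * ((p - 1) * P2 + (p - 2) * P1) / (1 + s) ^+ 3 by field.
exact: key.
Unshelve. all: by end_near. Qed.

(** Written over the common factor s^(p-3), phi'' is a difference of two
    nonnegative fractions, and each of them is below the bound. *)
Lemma phi''_le s : 3 < p -> 0 < s ->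
  `|phi'' s| <= p * (p - 1) * s `^ (p - 3).
Proof.
move=> p3 s0; have d0 : 0 < 1 + s by lra.
have P0 : 0 <= s `^ (p - 3) by exact: powR_ge0.
have E2 : s `^ (p - 2) = s * s `^ (p - 3).
  by rewrite powR_succ ?ltW//; [congr (_ * _ `^ _); ring|lra].
have E1 : s `^ (p - 1) = s * (s * s `^ (p - 3)).
  by rewrite -E2 powR_succ ?ltW//; [congr (_ * _ `^ _); ring|lra].
rewrite /phi'' E1 E2; set P := s `^ _; rewrite -/P in P0; clearbody P.
(* clearing denominators leaves polynomials in s with nonnegative coefficients *)
set A := (X in X - _); set B := (X in _ - X).
have A0 : 0 <= A.
  apply: divr_ge0; last by rewrite exprn_ge0// ltW.
  by rewrite addr_ge0// !mulr_ge0//; lra.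
have B0 : 0 <= B.
  apply: divr_ge0; last by rewrite exprn_ge0// ltW.
  by rewrite mulr_ge0// addr_ge0// !mulr_ge0//; lra.
have sP : 0 <= s * P by rewrite mulr_ge0// ltW.
have ssP : 0 <= s * (s * P) by rewrite mulr_ge0// ltW.
have sssP : 0 <= s * (s * (s * P)) by rewrite mulr_ge0// ltW.
have AK : A <= p * (p - 1) * P.
  rewrite ler_pdivrMr ?exprn_gt0// -subr_ge0.
  rewrite (_ : _ - _ = (p - 1) * (2 * P + (p + 2) * (s * P)
    + p * (s * (s * P)))); last ring.
  apply: mulr_ge0; first lra.
  by do ?[apply: addr_ge0]; apply: mulr_ge0 => //; lra.
have BK : B <= p * (p - 1) * P.
  rewrite ler_pdivrMr ?exprn_gt0// -subr_ge0.
  rewrite (_ : _ - _ = (p - 1) * (p * P + (3 * p - 2) * (s * P)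
    + (3 * p - 2) * (s * (s * P)) + p * (s * (s * (s * P))))
    + 2 * (s * (s * P))); last ring.
  apply: addr_ge0; last by rewrite mulr_ge0.
  apply: mulr_ge0; first lra.
  by do ?[apply: addr_ge0]; apply: mulr_ge0 => //; lra.
by rewrite ler_norml; apply/andP; split; lra.
Qed.

(** On one side of 0 the remainder is (phi'(c) - phi'(t)) h with c between t and
    t + h, and a second mean value step bounds the bracket by |phi''(d)| |h|.
    Across 0 no cancellation is needed: every term is already of order
    |h|^(p-1) = |h|^(p-3) |h|^2. *)
Lemma phi_taylor t h : 3 < p ->
  `|phi (t + h) - phi t - phi' t * h|
  <= p * (p - 1) * ((`|t| + `|h|) `^ (p - 3) * `|h| `^ 2).
Proof.
move=> p3.
have C0 : 0 <= p * (p - 1) by apply: mulr_ge0; lra.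
(* phi is odd and phi' is even *)
wlog t0 : t h / 0 <= t.
  move=> H; have [|/ltW t0] := leP 0 t; first exact: H.
  have := H (- t) (- h); rewrite oppr_ge0 => /(_ t0).
  rewrite -opprD !phiN phi'N !normrN.
  by rewrite mulrN -!opprD normrN.
have [tn h0] := (normr_ge0 t, normr_ge0 h).
have h2 : `|h| `^ 2 = `|h| * `|h|.
  by rewrite (powR_mulrn 2) ?normr_ge0// expr2.
have [/andP[tgt0 th0]|] := boolP ((0 < t) && (0 < t + h)).
  have phid s (s0 : 0 < s) := @phi_derive s s0 ltac:(lra).
  have [c [c0 ct ->]] := mean_value_gt0 phid tgt0 th0.
  have thE : t + h - t = h by ring.
  rewrite thE in ct *.
  rewrite -mulrBl normrM.
  have [d [d0 dt ->]] := mean_value_gt0 phi'_derive tgt0 c0.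
  rewrite normrM h2 !mulrA.
  have dle : d <= `|t| + `|h|.
    by rewrite (ger0_norm t0); have := ler_norm (d - t); lra.
  apply: ler_pM; rewrite ?mulr_ge0//.
  apply: ler_pM => //; apply: (le_trans (phi''_le p3 d0)).
  apply: ler_wpM2l => //; apply: ge0_ler_powR; rewrite ?nnegrE; lra.
rewrite negb_and -!leNgt => th.
have [tH thH] : `|t| <= `|h| /\ `|t + h| <= `|h|.
  case/orP: th => th.
    have -> : t = 0 by lra.
    by rewrite normr0 add0r.
  by rewrite (ger0_norm t0) (ler0_norm th) ler0_norm; lra.
have mono r u : 0 <= r -> 0 <= u -> u <= `|h| -> u `^ r <= `|h| `^ r.
  by move=> r0 u0 uh; apply: ge0_ler_powR; rewrite ?nnegrE.
have E2 : `|h| `^ (p - 2) = `|h| * `|h| `^ (p - 3).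
  by rewrite powR_succ//; [congr (_ * _ `^ _); ring|lra].
have E1 : `|h| `^ (p - 1) = `|h| * `|h| `^ (p - 2).
  by rewrite powR_succ//; [congr (_ * _ `^ _); ring|lra].
have b1 : `|phi (t + h)| <= `|h| `^ (p - 1).
  by apply: (le_trans (phi_le _)); apply: mono => //; lra.
have b2 : `|phi t| <= `|h| `^ (p - 1).
  by apply: (le_trans (phi_le _)); apply: mono => //; lra.
have b3 : `|phi' t * h| <= (p - 1) * `|h| `^ (p - 1).
  rewrite normrM E1 [_ * `|_| `^ _]mulrC mulrA; apply: ler_pM => //.
  apply: (le_trans (@phi'_le _ _)); first lra.
  by apply: ler_wpM2l; [lra|apply: mono => //; lra].
apply: (@le_trans _ _ ((p + 1) * `|h| `^ (p - 1))).
  apply: (le_trans (ler_normB _ _)).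
  have := ler_normB (phi (t + h)) (phi t); lra.
rewrite E1 E2 h2; apply: ler_pM.
- lra.
- by rewrite !mulr_ge0 ?powR_ge0.
- (* p (p - 1) - (p + 1) = (p - 3) (p + 1) + 2 *)
  have : 0 <= (p - 3) * (p + 1) by apply: mulr_ge0; lra.
  nra.
- rewrite mulrA mulrC; apply: ler_wpM2r; first exact: mulr_ge0.
  by apply: ge0_ler_powR; rewrite ?nnegrE; lra.
Qed.

End scalar.

(** * Norms in the sequence spaces *)

Lemma Lfun_countingP {R : realType} (r : R) (y : nat -> R) : 0 < r ->
  (\sum_(0 <= n <oo) (`|y n| `^ r)%:E < +oo)%E ->
  y \in Lfun (@counting nat R) r%:E.
Proof.
move=> r0 yoo; apply/andP; split; rewrite inE//=.
by rewrite /finite_norm Lnorm_counting//; exact: poweR_lty.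
Qed.

Section ell_norm.
Context {R : realType} {p : R} {p1 : (1 <= p%:E)%E}.
Implicit Types (x : ell p1).

Let p0 : 0 < p := ell_p_gt0 p1.

Lemma ell_norm_powR x :
  (\sum_(0 <= n <oo) (`|x n| `^ p)%:E = (`|x| `^ p)%:E)%E.
Proof.
have /(congr1 (fun z => (z `^ p)%E)) := ell_normE x.
rewrite poweR_EFin -poweRrM mulVf ?gt_eqF// poweRe1//.
by apply: nneseries_ge0 => n _ _; rewrite lee_fin powR_ge0.
Qed.

Lemma ell_norm_leP x (A : R) : 0 <= A ->
  (\sum_(0 <= n <oo) (`|x n| `^ p)%:E <= (A `^ p)%:E)%E -> `|x| <= A.
Proof.
move=> A0; rewrite ell_norm_powR lee_fin => xA.
rewrite leNgt; apply/negP => Ax; move: xA; rewrite leNgt => /negP; apply.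
by rewrite gt0_ltr_powR ?nnegrE.
Qed.

Lemma ell_abs_subproof x : (fun n => `|x n|) \in Lfun (@counting nat R) p%:E.
Proof.
apply: (Lfun_countingP p0); under eq_eseriesr do rewrite normr_id.
by rewrite ell_norm_powR ltry.
Qed.

(** Taking absolute values inside the space makes the triangle inequality bound
    the norm of |x| + |h|, the weight of the Taylor remainder. *)
Definition ell_abs x : ell p1 := Lfun_Sub p1 (ell_abs_subproof x).

Lemma norm_ell_abs x : `|ell_abs x| = `|x|.
Proof.
apply: (@powR_injective _ p p0); rewrite ?nnegrE//; apply: EFin_inj.
by rewrite -!ell_norm_powR; apply: eq_eseriesr => n _; rewrite normr_id.
Qed.

End ell_norm.

(** * From power bounds on coordinates to norm bounds *)

Section interpolation.
Context {R : realType} {p q : R} {p1 : (1 <= p%:E)%E} (q1 : (1 <= q%:E)%E).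
Hypothesis pq : p^-1 + q^-1 = 1.
Variables (alpha beta C A : R) (a h : ell p1) (y : nat -> R).
Hypotheses (alpha0 : 0 <= alpha) (beta0 : 0 < beta).
Hypothesis alphabeta : alpha + beta = p - 1.
Hypotheses (A0 : 0 < A) (aA : `|a| <= A) (C0 : 0 <= C).
Hypothesis yP : forall n, `|y n| <= C * (`|a n| `^ alpha * `|h n| `^ beta).

Let p0 : 0 < p := ell_p_gt0 p1.
Let q0 : 0 < q := ell_p_gt0 q1.

Let mulBq : (p - 1) * q = p.
Proof.
have [pn0 qn0] := (lt0r_neq0 p0, lt0r_neq0 q0).
have : (p^-1 + q^-1) * (p * q) = p * q by rewrite pq mul1r.
rewrite (_ : (p^-1 + q^-1) * (p * q) = q + p); first by lra.
by field; rewrite ?pn0 ?qn0.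
Qed.

(** After normalization u = |a_n| / A and w = |h_n| / ||h||, the bound reads
    |y_n| <= K u^alpha w^beta <= K max(u, w)^(p-1), with
    K = C A^alpha ||h||^beta; as (p-1) q = p, raising it to the power q gives
    K^q max(u, w)^p <= K^q (u^p + w^p), whose sum over n is at most
    2 K^q <= (2K)^q. The statement is about the series, not about a norm in l_q,
    because it is also what proves that y belongs to l_q. *)
Lemma interpolation :
  (\sum_(0 <= n <oo) (`|y n| `^ q)%:E
    <= ((2 * C * (A `^ alpha * `|h| `^ beta)) `^ q)%:E)%E.
Proof.
(* the normalization needs h nonzero; if h = 0 then y = 0, as 0 < beta *)
have [h0|h0] := eqVneq h 0.
  rewrite eseries0 ?lee_fin ?powR_ge0// => n _ _.
  have := yP n; rewrite h0 normr0 powR0 ?gt_eqF// !mulr0 normr_le0 => /eqP ->.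
  by rewrite normr0 powR0// gt_eqF.
have {h0} H0 : 0 < `|h| by rewrite normr_gt0.
set K := C * (A `^ alpha * `|h| `^ beta).
have K0 : 0 <= K by rewrite !mulr_ge0 ?powR_ge0.
have scale_le n : `|y n| `^ q <=
    K `^ q * (A `^ p)^-1 * `|a n| `^ p + K `^ q * (`|h| `^ p)^-1 * `|h n| `^ p.
  set u := `|a n| / A; set w := `|h n| / `|h|.
  have [u0 w0] : 0 <= u /\ 0 <= w by split; rewrite divr_ge0// ltW.
  set m := Num.max u w.
  have m0 : 0 <= m by rewrite le_max u0.
  have ym : `|y n| <= K * m `^ (p - 1).
    apply: (le_trans (yP n)).
    rewrite -[`|a n|](divfK (lt0r_neq0 A0)) -[`|h n|](divfK (lt0r_neq0 H0)).
    rewrite -/u -/w.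
    rewrite (powRM _ u0 (ltW A0)) (powRM _ w0 (ltW H0)).
    rewrite -alphabeta powRD ?(gt_eqF (ltr_wpDl alpha0 beta0))//.
    rewrite /K -[leRHS]mulrA; apply: ler_wpM2l => //.
    rewrite mulrACA mulrC; apply: ler_wpM2l; first by rewrite mulr_ge0 ?powR_ge0.
    apply: ler_pM; rewrite ?powR_ge0//; apply: ge0_ler_powR; rewrite ?nnegrE//.
    - by rewrite le_max lexx.
    - exact: ltW.
    - by rewrite le_max lexx orbT.
  apply: (@le_trans _ _ (K `^ q * m `^ p)).
    rewrite -[X in _ * _ `^ X]mulBq powRrM -powRM ?powR_ge0//.
    by apply: ge0_ler_powR; rewrite ?nnegrE ?mulr_ge0 ?powR_ge0// ltW.
  rewrite -!mulrA -mulrDr; apply: ler_wpM2l; first exact: powR_ge0.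
  have powRV z : 0 <= z -> z^-1 `^ p = (z `^ p)^-1.
    by move=> z0; rewrite -(powR_inv1 z0) powRAC powR_inv1 ?powR_ge0.
  have uE : u `^ p = (A `^ p)^-1 * `|a n| `^ p.
    by rewrite /u powRM ?invr_ge0 ?(ltW A0)// powRV ?(ltW A0)// mulrC.
  have wE : w `^ p = (`|h| `^ p)^-1 * `|h n| `^ p.
    by rewrite /w powRM ?invr_ge0 ?(ltW H0)// powRV ?(ltW H0)// mulrC.
  rewrite -uE -wE /m; case: (leP u w) => _.
    by rewrite lerDr powR_ge0.
  by rewrite lerDl powR_ge0.
apply: (@le_trans _ _ (\sum_(0 <= n <oo)
    ((K `^ q * (A `^ p)^-1)%:E * (`|a n| `^ p)%:E +
     (K `^ q * (`|h| `^ p)^-1)%:E * (`|h n| `^ p)%:E))%E).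
  apply: lee_nneseries => n _; first by rewrite lee_fin powR_ge0.
  by rewrite -!EFinM -EFinD lee_fin.
have k1 : 0 <= K `^ q * (A `^ p)^-1 by rewrite mulr_ge0 ?invr_ge0 ?powR_ge0.
have k2 : 0 <= K `^ q * (`|h| `^ p)^-1 by rewrite mulr_ge0 ?invr_ge0 ?powR_ge0.
rewrite nneseriesD; last 2 first.
- by move=> n _ _; rewrite -EFinM lee_fin mulr_ge0 ?powR_ge0.
- by move=> n _ _; rewrite -EFinM lee_fin mulr_ge0 ?powR_ge0.
rewrite !nneseriesZl; last 2 first.
- by move=> n _; rewrite lee_fin powR_ge0.
- by move=> n _; rewrite lee_fin powR_ge0.
rewrite !ell_norm_powR -!EFinM -EFinD lee_fin.
have s1 : K `^ q * (A `^ p)^-1 * `|a| `^ p <= K `^ q.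
  rewrite -mulrA ler_piMr ?powR_ge0// ler_pdivrMl ?powR_gt0// mulr1.
  by apply: ge0_ler_powR; rewrite ?nnegrE// ltW.
rewrite -[_ * (`|h| `^ p)^-1 * _]mulrA mulVf ?gt_eqF ?powR_gt0// mulr1.
rewrite -mulrA -/K powRM//.
have q2 : 2 <= 2 `^ q by apply: le1r_powR; [lra|rewrite -lee_fin].
have := powR_ge0 K q; nra.
Qed.

End interpolation.

(** * The derivative of the mapping *)

(** Differentiability is stated for the differential chosen by 'd; uniqueness of
    the differential identifies that choice with df. *)
Lemma differentiable_expansion {R : numFieldType} {V W : normedModType R}
    (f : V -> W) (df : {linear V -> W}) (x : V) :
  continuous df -> f \o shift x = cst (f x) + df +o_ 0 id ->
  differentiable f x.
Proof.
move=> dfc dfx.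
have E := diff_unique dfc dfx.
by apply/diff_locallyP; rewrite E.
Qed.

Section derivative_of_J.
Context {R : realType} {p q : R} {p1 : (1 <= p%:E)%E} {q1 : (1 <= q%:E)%E}.
Hypotheses (p3 : 3 < p) (pq : p^-1 + q^-1 = 1).
Implicit Types (x v h : ell p1).

Local Notation JJ := (J pq : ell p1 -> ell q1).

Let dJ_le x v n : `|phi' p (x n) * v n| <=
  (p - 1) * (`|x n| `^ (p - 2) * `|v n| `^ 1).
Proof.
rewrite normrM powRr1// mulrA; apply: ler_wpM2r => //.
by apply: phi'_le; have := p3; lra.
Qed.

Lemma dJ_bound x v :
  (\sum_(0 <= n <oo) (`|phi' p (x n) * v n| `^ q)%:E <=
   ((2 * (p - 1) * ((`|x| + 1) `^ (p - 2) * `|v| `^ 1)) `^ q)%:E)%E.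
Proof.
have p3' := p3.
(* the radius |x| + 1 rather than |x|, so that it is positive also for x = 0 *)
apply: (interpolation (p1 := p1) q1 pq _ _ _ _ _ _ (dJ_le x v)).
- by lra.
- by lra.
- by lra.
- by rewrite ltr_wpDl.
- by rewrite lerDl.
- by lra.
Qed.

Fact dJ_mem x v :
  (fun n => phi' p (x n) * v n) \in Lfun (@counting nat R) q%:E.
Proof.
apply: (Lfun_countingP (ell_p_gt0 q1)); apply: le_lt_trans (dJ_bound x v) _.
by rewrite ltry.
Qed.

Definition dJ x v : ell q1 := Lfun_Sub q1 (dJ_mem x v).

Fact dJ_linear x : linear (dJ x).
Proof.
move=> a u v; apply: (iffRL (LfuneqP _ _)) => n.
have key : phi' p (x n) * (a * u n + v n) =
  a * (phi' p (x n) * u n) + phi' p (x n) * v n by ring.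
exact: key.
Qed.

HB.instance Definition _ x :=
  GRing.isLinear.Build R (ell p1) (ell q1) *:%R (dJ x) (dJ_linear x).

Lemma dJ_norm x v :
  `|dJ x v| <= 2 * (p - 1) * (`|x| + 1) `^ (p - 2) * `|v|.
Proof.
rewrite -[X in _ * X]powRr1// -mulrA.
apply: ell_norm_leP; last exact: dJ_bound.
by rewrite !mulr_ge0 ?powR_ge0//; have := p3; lra.
Qed.

Lemma dJ_continuous x : continuous (dJ x).
Proof.
apply/linear_bounded_continuous/linear_boundedP.
apply: (filterS _ (nbhs_pinfty_ge (num_real
  (2 * (p - 1) * (`|x| + 1) `^ (p - 2))))) => r Kr v.
by apply: (le_trans (dJ_norm x v)); exact: ler_wpM2r.
Qed.

(** The quadratic bound that makes the remainder negligible; it rests on p > 3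
    through the nonnegative exponent p - 3. *)
Lemma J_remainder x h : `|h| <= 1 ->
  `|JJ (x + h) - JJ x - dJ x h| <=
  2 * (p * (p - 1)) * ((`|x| + 1) `^ (p - 3) * `|h| `^ 2).
Proof.
move=> h1; apply: ell_norm_leP.
  by rewrite !mulr_ge0 ?powR_ge0//; have := p3; lra.
have p3' := p3.
(* alpha = p - 3, beta = 2; the radius is |x| + 1 since |h| <= 1 *)
apply: (interpolation q1 pq (a := ell_abs x + ell_abs h)).
- by lra.
- by lra.
- by lra.
- by rewrite ltr_wpDl.
- by apply: (le_trans (ler_normD _ _)); rewrite !norm_ell_abs; lra.
- by apply: mulr_ge0; lra.
move=> n; have := phi_taylor (x n) (h n) p3.
by rewrite -[`|x n| + `|h n|]ger0_norm ?addr_ge0.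
Qed.

Lemma J_expansion x : JJ \o shift x = cst (JJ x) + dJ x +o_ 0 id.
Proof.
apply/eqaddoP => _/posnumP[e].
set K := 2 * (p * (p - 1)) * (`|x| + 1) `^ (p - 3).
have K0 : 0 <= K by rewrite !mulr_ge0 ?powR_ge0//; have := p3; lra.
near=> h.
have h1 : `|h| <= 1 by near: h; exact: nbhs0_le.
(* K + 1 in place of K keeps the denominator positive *)
have hK : `|h| <= e%:num / (K + 1).
  by near: h; apply: nbhs0_le; rewrite divr_gt0// ltr_wpDl.
have -> : (JJ \o shift x - (cst (JJ x) + dJ x)) h = JJ (x + h) - JJ x - dJ x h.
  have key : JJ (h + x) - (JJ x + dJ x h) = JJ (x + h) - JJ x - dJ x h.
    by rewrite opprD addrA [h + x]addrC.
  exact: key.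
apply: (le_trans (J_remainder x h1)).
rewrite mulrA -/K (powR_mulrn 2)// expr2 mulrA; apply: ler_wpM2r => //.
apply: (@le_trans _ _ ((K + 1) * `|h|)).
  by apply: ler_wpM2r => //; lra.
by rewrite mulrC -ler_pdivlMr// ltr_wpDl.
Unshelve. all: by end_near. Qed.

Lemma J_differentiable x : differentiable JJ x.
Proof.
exact: (differentiable_expansion (df := dJ x) (@dJ_continuous x)
  (J_expansion x)).
Qed.

Lemma diff_J x : 'd JJ x = dJ x :> (ell p1 -> ell q1).
Proof. exact: (diff_unique (df := dJ x) (@dJ_continuous x) (J_expansion x)). Qed.

End derivative_of_J.

Theorem corollary7p3 (R : realType) (p q : R)
    (p_gt3 : 3 < p) (pq : p^-1 + q^-1 = 1) :
  let lp := ell (exponent_ge1 p_gt3) in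
  let lq := ell (conjugate_exponent_ge1 p_gt3 pq) in
  let JJ : lp -> lq := J pq in
  (forall x : lp, gateaux_differentiable JJ x) /\
  (forall x : lp, differentiable JJ x /\
    forall v : lp, v != 0 ->
      'D_v JJ x = 'd JJ x v /\
      forall n : nat, ('D_v JJ x) n =
        ((p - 1) * `|x n| `^ (p - 2) + (p - 2) * `|x n| `^ (p - 1))
          / (1 + `|x n|) ^+ 2 * v n).
Proof.
move=> lp lq JJ; have dJJ x : differentiable JJ x by exact: J_differentiable.
split=> [x v _|x]; first exact: diff_derivable.
split=> // v _; rewrite deriveE//; split=> // n.
by rewrite (diff_J p_gt3).
Qed.
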